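(* For all $p, q \in \mathbb{R}$ and all real $b > 0$ with $b \neq 1$, we have \[ \int_p^q b^t\,dt = \frac{b^q - b^p}{\log(b)}. \] In particular, \[ \int_p^q e^t\,dt = e^q - e^p. \]
   Context: Integrals are Riemann integrals, with the convention $\int_p^q = -\int_q^p$ when $p > q$ and $\int_p^p = 0$. For $x>0$, $\log(x) := \int_1^x \frac{dt}{t}$, which is a bijection from $(0,\infty)$ onto $\mathbb{R}$. The function $\exp : \mathbb{R} \to (0,\infty)$ is the inverse of $\log$, $e := \exp(1)$, and for $b>0$ and $x \in \mathbb{R}$, $b^x := \exp(x\log(b))$. *)

(* Defs.v *)
From Stdlib Require Import Reals Lra.
From Coquelicot Require Import Coquelicot.

Open Scope R_scope.

(** The logarithm may be defined as the integral of [1/t] from [1], and the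
    exponential as its inverse on [(0, +oo)].  [ln] and [exp] are introduced
    differently in the library, but satisfy these definitions: [ln_is_RInt]
    below for the former, [exp_pos], [ln_exp] and [exp_ln] for the latter.
    [Rpower b x] unfolds to [exp (x * ln b)]. *)
Lemma ln_is_RInt (x : R) : 0 < x -> is_RInt (fun t => 1 / t) 1 x (ln x).
Proof.
  intros Hx.
  assert (Hpos : forall t, Rmin 1 x <= t <= Rmax 1 x -> 0 < t).
  { intros t [Ht _]. apply Rlt_le_trans with (2 := Ht).
    apply Rmin_glb_lt; lra. }
  replace (ln x) with (minus (ln x) (ln 1))
    by (rewrite ln_1; unfold minus, plus, opp; simpl; ring).
  apply (is_RInt_derive ln (fun t => 1 / t)).
  - intros t Ht. specialize (Hpos t Ht). auto_derive; lra.
  - intros t Ht. specialize (Hpos t Ht).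
    apply (ex_derive_continuous (fun t => 1 / t)). auto_derive. lra.
Qed.

(* Main.v *)
Require Import Defs.
From Stdlib Require Import Reals Lra.
From Coquelicot Require Import Coquelicot.
Open Scope R_scope.

(** Since [Rpower b t] is [exp (t * ln b)], differentiating it brings down a factor [ln b], nonzero
    because [b <> 1]. So [Rpower b t / ln b] is an antiderivative of the continuous integrand, and
    the fundamental theorem of calculus concludes. The case of e is [ln (exp 1) = 1]. *)

Lemma ln_neq_0 (b : R) : 0 < b -> b <> 1 -> ln b <> 0.
Proof.
  intros Hb Hb1 Hln. apply Hb1, ln_inv; [exact Hb | lra |].
  rewrite ln_1. exact Hln.
Qed.

Lemma is_RInt_Rpower_exponent (p q b : R) : 0 < b -> b <> 1 ->
  is_RInt (fun t => Rpower b t) p q ((Rpower b q - Rpower b p) / ln b).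
Proof.
  intros Hb Hb1. assert (Hln := ln_neq_0 b Hb Hb1).
  replace ((Rpower b q - Rpower b p) / ln b)
    with (minus (Rpower b q / ln b) (Rpower b p / ln b))
    by (unfold minus, plus, opp; simpl; field; exact Hln).
  (* Both conditions are checked at every real [t], which covers either order of [p] and [q]. *)
  apply (is_RInt_derive (fun t => Rpower b t / ln b)); intros t _; unfold Rpower.
  - auto_derive; [exact I | field; exact Hln].
  - apply (ex_derive_continuous (fun t => exp (t * ln b))). auto_derive. exact I.
Qed.

Theorem theorem3p7 :
  (forall p q b : R, 0 < b -> b <> 1 ->
     is_RInt (fun t => Rpower b t) p q ((Rpower b q - Rpower b p) / ln b)) /\
  (forall p q : R,
     is_RInt (fun t => Rpower (exp 1) t) p q
       (Rpower (exp 1) q - Rpower (exp 1) p)).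
Proof.
  split; [exact is_RInt_Rpower_exponent | intros p q].
  replace (Rpower (exp 1) q - Rpower (exp 1) p)
    with ((Rpower (exp 1) q - Rpower (exp 1) p) / ln (exp 1))
    by (rewrite ln_exp; field).
  apply is_RInt_Rpower_exponent; [apply exp_pos |].
  (* The bound [1 + x < exp x] at [x = 1] gives 2 < e, so e differs from 1. *)
  assert (H := exp_ineq1 1). lra.
Qed.
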